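(* Let $\mathbf w = w_1 w_2 w_3\ldots$ be an infinite word over the alphabet of positive integers, and for $n\ge 1$ let $p(n,\mathbf w)$ be the number of distinct factors of length $n$ of $\mathbf w$. If there exists an integer $k$ such that $$p(n,\mathbf w)\le n+k \quad\text{for all } n\ge 1,$$ then the real number $[0;w_1,w_2,\ldots]$ has a L\'evy constant.
   Context: For an infinite word $\mathbf w=w_1w_2\ldots$, $p(n,\mathbf w)=\operatorname{Card}\{w_{i+1}\ldots w_{i+n} : i\ge 1\}$ (the complexity function). For an irrational real number $\alpha=[a_0;a_1,a_2,\ldots]$ (regular continued fraction expansion), let $P_n(\alpha)/Q_n(\alpha)=[a_0;a_1,\ldots,a_n]$ in lowest terms, $n\ge1$. We say $\alpha$ has a L\'evy constant if the sequence $\big(\tfrac1n\log Q_n(\alpha)\big)_{n\ge1}$ converges to a finite limit, denoted $\mathcal L(\alpha)$. *)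

(* Defs.v *)
From HB Require Import structures.
From mathcomp Require Import all_boot all_order all_algebra.
From mathcomp Require Import all_classical all_reals all_analysis.

Set Implicit Arguments.
Unset Strict Implicit.
Unset Printing Implicit Defensive.

Import Order.TTheory GRing.Theory Num.Theory.
Import numFieldNormedType.Exports.
Local Open Scope classical_set_scope.
Local Open Scope ring_scope.

(* An infinite word w_1 w_2 w_3 ... is a function w : nat -> nat with
   w i standing for the letter w_{i+1}. *)

Definition word_factor (w : nat -> nat) (n i : nat) : n.-tuple nat :=
  [tuple w (i + j)%N | j < n].

(* p(n, w); +oo when w has infinitely many factors of length n. *)
Definition complexity (R : realType) (n : nat) (w : nat -> nat) : \bar R :=
  counting (range (word_factor w n)).

(* [a_0; a_1, ..., a_n] in the field F *)
Fixpoint cfrac (F : fieldType) (a : nat -> int) (n : nat) : F :=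
  if n is m.+1 then (a 0%N)%:~R + (cfrac F (fun i => a i.+1) m)^-1
  else (a 0%N)%:~R.

(* [a_0; a_1, a_2, ...]; the limit exists as soon as a_n >= 1 for n >= 1. *)
Definition inf_cfrac (R : realType) (a : nat -> int) : R :=
  lim (cfrac R a n @[n --> \oo]).

Definition cf_quotients_of_word (w : nat -> nat) (n : nat) : int :=
  if n is m.+1 then (w m)%:Z else 0.

(* Complete quotients: x_0 = x and x_{n+1} = 1 / (x_n - floor x_n). *)
Fixpoint complete_quotient (R : realType) (x : R) (n : nat) : R :=
  if n is m.+1 then
    let y := complete_quotient x m in (y - (Num.floor y)%:~R)^-1
  else x.

Definition partial_quotient (R : realType) (x : R) (n : nat) : int :=
  Num.floor (complete_quotient x n).

(* P_n(x) / Q_n(x); being of type rat, it is automatically in lowest terms. *)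
Definition convergent (R : realType) (x : R) (n : nat) : rat :=
  cfrac rat (partial_quotient x) n.

Definition convergent_den (R : realType) (x : R) (n : nat) : int :=
  denq (convergent x n).

(* The shift n.+1 makes the sequence start at index 1. *)
Definition has_Levy_constant (R : realType) (x : R) : Prop :=
  irrational x /\
  cvgn (fun n : nat => ln ((convergent_den x n.+1)%:~R : R) / n.+1%:R).

(* Main.v *)
Require Import Defs.
From mathcomp Require Import all_boot all_order all_algebra finmap.
From mathcomp Require Import all_classical all_reals all_analysis.
From mathcomp Require Import zify ring lra.
Import Order.TTheory GRing.Theory Num.Theory.
Import numFieldNormedType.Exports.
Local Open Scope classical_set_scope.
Local Open Scope ring_scope.

(** Write [K(u)] for the continuant of a word [u], so that [Q_n = K(w_1 .. w_n)].
Since [K(u) K(v) <= K(uv) <= 2 K(u) K(v)], the function [ln K] is additive on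
words up to a bounded error.  As [p(n) <= n + k], infinitely many [n] satisfy
[p(n+1) <= p(n) + 1], i.e. at most one factor [r] of length [n] has several
right extensions; unless [w] is eventually periodic, [r] then occurs in every
window of length [3n], because avoiding [r] for [p(n) + 1] steps creates a
cycle.  Now let [M] and [m] be the extreme asymptotic slopes of [ln K] over
all windows.  Recurrent words fill a fixed proportion of any long window, so
both [M] and [m] must agree with [ln K(r) / n] up to [o(1)]: hence [M = m]. *)

(** * Almost additive functions of windows and their extreme slopes *)

Definition subadditive_from {R : realType} (F : nat -> nat -> R) (N : nat)
    (c : R) : Prop :=
  forall i m n, (N <= i)%N -> F i (m + n)%N <= F i m + F (i + m)%N n + c.

(** The infimum of this set is the largest asymptotic slope over windows starting at [N] or later;
    for [- F] it is minus the smallest slope of [F]. *)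
Definition upper_slopes {R : realType} (F : nat -> nat -> R) (N : nat) : set R :=
  [set x | exists K, forall i n, (N <= i)%N -> F i n <= x * n%:R + K].

(** The recurring word is forgotten and only its value kept, so that the notion passes from [F] to
    [- F] by negating [r]. *)
Definition recurrent_value {R : realType} (F : nat -> nat -> R)
    (N C n : nat) (r : R) : Prop :=
  forall i, (N <= i)%N ->
    exists j, [/\ (i <= j)%N, (j + n <= i + C * n)%N & F j n = r].

Lemma archi_nat_gt (R : realType) (x : R) :
  exists n : nat, forall m, (n <= m)%N -> x < m%:R.
Proof.
exists (Num.truncn x).+1 => m nm; apply: lt_le_trans (truncnS_gt x) _.
by rewrite ler_nat.
Qed.

Section Growth.
Context (R : realType).
Implicit Types (F : nat -> nat -> R) (N C n : nat) (c B : R).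

Lemma upper_slopes_has_inf F N B :
  (forall i n, `|F i n| <= B * n%:R) -> has_inf (upper_slopes F N).
Proof.
move=> FB; split.
  exists B, 0 => i n _; rewrite addr0; exact: le_trans (ler_norm _) (FB i n).
exists (- B) => x [K FK]; rewrite leNgt; apply/negP => xB.
have [n /(_ n (leqnn n)) hn] := archi_nat_gt R (K / (- B - x)).
have d0 : 0 < - B - x by lra.
move: hn; rewrite ltr_pdivrMr// => hn.
have := FK N n (leqnn N); have := FB N n; rewrite ler_norml => /andP[h1 _] h2.
lra.
Qed.

(** A long window is cut into blocks of length [b] and a shorter remainder; the hypothesis on blocks
    already includes the cost [c] of each cut. *)
Lemma block_upper_slope F N c B (b : nat) (y : R) :
  subadditive_from F N c -> (forall i n, `|F i n| <= B * n%:R) -> (0 < b)%N ->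
  (forall i, (N <= i)%N -> F i b + c <= y * b%:R) -> upper_slopes F N y.
Proof.
(* The remainder, of length [s < b], contributes at most [B * b]; the other term makes up for
   [y * s] when [y] is negative. *)
move=> subF FB b0 Fb; exists ((B + `|y|) * b%:R) => i n Ni.
have B0 : 0 <= B.
  by have := FB 0%N 1%N; rewrite mulr1; apply: le_trans.
rewrite (divn_eq n b); have := ltn_pmod n b0.
move: (n %/ b)%N (n %% b)%N => q s sb.
have sbR : (s%:R : R) <= b%:R by rewrite ler_nat ltnW.
have s0 : 0 <= (s%:R : R) by [].
suff {Ni} h : forall i, (N <= i)%N ->
    F i (q * b + s)%N <= y * (q * b)%:R + B * b%:R.
  apply: le_trans (h i Ni) _; rewrite natrD.
  have : - y <= `|y| by rewrite -normrN ler_norm.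
  have : 0 <= `|y| by [].
  nra.
elim: q {i} => [|q IH] i Ni.
  rewrite mul0n add0n mulr0 add0r.
  apply: le_trans (ler_norm _) _; apply: le_trans (FB _ _) _.
  exact: ler_wpM2l.
rewrite mulSn -addnA; apply: le_trans (subF _ _ _ Ni) _.
have := IH (i + b)%N (leq_trans Ni (leq_addr _ _)).
have := Fb i Ni; rewrite natrD; lra.
Qed.

(* If a word of length n met in every window of length C n had too small a
   value, then cutting long windows around its occurrences would produce a
   slope smaller than the infimum. *)
Lemma recurrent_value_ge F N C c B (e : R) :
  subadditive_from F N c -> (forall i n, `|F i n| <= B * n%:R) -> (0 < C)%N ->
  0 < e ->
  exists n0, forall n r, (n0 <= n)%N -> recurrent_value F N C n r ->
    (inf (upper_slopes F N) - e) * n%:R <= r.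
Proof.
move=> subF FB C0 e0; set M := inf _.
have C0R : 0 < (C%:R : R) by rewrite ltr0n.
have infF := @upper_slopes_has_inf F N B FB.
have eta0 : 0 < e / (2 * C%:R) by rewrite divr_gt0// mulr_gt0.
have [x [K FK] xM] := inf_adherent eta0 infF; rewrite -/M in xM.
(* Two outer pieces cost [K] each; two cuts and the block hypothesis cost [3 * c]. Their sum must
   stay below [e * n / 4]. *)
have [n0 hn0] := archi_nat_gt R (4 * (2 * K + 3 * c) / e).
exists n0.+1 => n r n0n rec; rewrite leNgt; apply/negP => rM.
have n_gt0 : (0 < n)%N by exact: leq_trans n0n.
have nR : 0 < (n%:R : R) by rewrite ltr0n.
have := hn0 _ (ltnW n0n); rewrite ltr_pdivrMr// => hn.
(* In a window of length [C * n], the occurrence loses [e * n] against slope [M], while the outer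
   pieces, of slope at most [M + e / (2 * C)], gain back at most [e * n / 2]. After the constants a
   loss of [e * n / 4] remains, that is [e / (4 * C)] per letter. *)
suff /(ge_inf infF.2) : upper_slopes F N (M - e / (4 * C%:R)).
  rewrite -/M; have : 0 < e / (4 * C%:R) by rewrite divr_gt0// mulr_gt0.
  lra.
apply: (block_upper_slope F N c B (C * n)%N) => //; first by rewrite muln_gt0 C0.
move=> i Ni; have [j [ij jn Fj]] := rec i Ni.
have -> : (C * n = (j - i) + (n + (i + C * n - (j + n))))%N by lia.
have h1 := subF i (j - i)%N (n + (i + C * n - (j + n)))%N Ni.
rewrite subnKC// in h1.
have h2 := subF j n (i + C * n - (j + n))%N (leq_trans Ni ij).
have h3 := FK i (j - i)%N Ni.
have h4 := FK (j + n)%N (i + C * n - (j + n))%N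
  (leq_trans Ni (leq_trans ij (leq_addr _ _))).
have eqL : (j - i)%:R + (i + C * n - (j + n))%:R + n%:R = C%:R * n%:R :> R.
  by rewrite -!natrD -natrM; congr _%:R; lia.
rewrite !natrD.
have p1 : 0 <= ((j - i)%:R : R) by [].
have p2 : 0 <= ((i + C * n - (j + n))%:R : R) by [].
move: (F _ _) (F i _) (F (j + n)%N _) (F j _) h1 h2 h3 h4 Fj p1 p2 eqL.
move: ((j - i)%:R : R) ((i + C * n - (j + n))%:R : R).
move=> a b F1 F2 F3 F4 h1 h2 h3 h4 Fj p1 p2 eqL.
set d := e / (4 * C%:R); have dE : d * C%:R = e / 4.
  by rewrite /d; field; lra.
have xMd : x <= M + 2 * d.
  apply: ltW; suff <- : e / (2 * C%:R) = 2 * d by [].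
  by rewrite /d; field; lra.
have ab : a + b = C%:R * n%:R - n%:R by lra.
have xab : x * (a + b) <= (M + 2 * d) * (a + b).
  by apply: ler_wpM2r => //; lra.
have e1 : (M + 2 * d) * (a + b)
  = M * (C%:R * n%:R - n%:R) + e / 2 * n%:R - 2 * d * n%:R.
  rewrite ab; have -> : e / 2 = 2 * (d * C%:R) by rewrite dE; lra.
  ring.
have d0 : 0 < d by rewrite /d divr_gt0// mulr_gt0.
have dn : 0 < d * n%:R by rewrite mulr_gt0.
have e2 : (M - d) * (a + (n%:R + b)) = M * (C%:R * n%:R) - e / 4 * n%:R.
  have -> : a + (n%:R + b) = C%:R * n%:R by lra.
  by rewrite -dE; ring.
lra.
Qed.

(** The upper slopes [M] of [F] and [M'] of [- F] squeeze [F] between about [- M' * n] and [M * n];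
    a recurrent value closes the gap. *)
Lemma average_cvg F N C c B :
  (forall i m n, `|F i (m + n)%N - F i m - F (i + m)%N n| <= c) ->
  (forall i n, `|F i n| <= B * n%:R) -> (0 < C)%N ->
  (forall n0, exists n r, (n0 <= n)%N /\ recurrent_value F N C n r) ->
  cvgn (fun n => F 0%N n.+1 / n.+1%:R).
Proof.
move=> addF FB C0 rec; pose G i n := - F i n.
have subF : subadditive_from F N c.
  by move=> i m n _; have := addF i m n; rewrite ler_norml => /andP[_]; lra.
have subG : subadditive_from G N c.
  by move=> i m n _; have := addF i m n; rewrite ler_norml /G => /andP[]; lra.
have GB i n : `|G i n| <= B * n%:R by rewrite normrN.
have infF := @upper_slopes_has_inf F N B FB.
have infG := @upper_slopes_has_inf G N B GB.
pose M := inf (upper_slopes F N); pose M' := inf (upper_slopes G N).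
(* The same [r] bounds both slopes: [(M - e / 2) * n <= r] and [(M' - e / 2) * n <= - r] add up to
   [(M + M') * n <= e * n]. *)
have MM' : M + M' <= 0.
  apply/ler_addgt0Pr => e e0.
  have e20 : 0 < e / 2 by lra.
  have [n1 h1] := recurrent_value_ge F N C c B (e / 2) subF FB C0 e20.
  have [n2 h2] := recurrent_value_ge G N C c B (e / 2) subG GB C0 e20.
  have [n [r [nn recn]]] := rec (n1 + n2).+1.
  have f1 := h1 n r ltac:(lia) recn.
  have f2 : (M' - e / 2) * n%:R <= - r.
    apply: h2; first lia.
    by move=> i /recn[j [ij jn <-]]; exists j.
  have n_gt0 : 0 < (n%:R : R) by rewrite ltr0n; lia.
  rewrite -/M in f1; rewrite add0r -(ler_pM2r n_gt0).
  lra.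
apply/cvg_ex; exists M; apply/cvgrPdist_le => e e0.
have e20 : 0 < e / 2 by lra.
have [x [K FK] xM] := inf_adherent e20 infF; rewrite -/M in xM.
have [y [K' GK] yM] := inf_adherent e20 infG; rewrite -/M' in yM.
(* The slope bounds hold only from position [N] on: [D] collects their constants, one cut at [N],
   the value of the prefix of length [N], and the slopes over these [N] letters. *)
pose D := `|K| + `|K'| + c + B * N%:R + (`|x| + `|y|) * N%:R.
have [n0 hn0] := archi_nat_gt R (D / (e / 2)).
exists (n0 + N)%N => // n /= n0n.
have nR : 0 < (n.+1%:R : R) by [].
have := hn0 n.+1 ltac:(lia); rewrite ltr_pdivrMr// => hn.
rewrite distrC -(@ler_pM2r _ n.+1%:R)//.
rewrite -[X in _ * X]gtr0_norm// -normrM mulrBl divfK ?gt_eqF//.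
have := addF 0%N N (n.+1 - N)%N.
rewrite subnKC ?add0n; last lia.
have := FK N (n.+1 - N)%N (leqnn N); have := GK N (n.+1 - N)%N (leqnn N).
have := FB 0%N N; rewrite /G natrB; last lia.
rewrite !ler_norml => /andP[a1 a2] a3 a4 /andP[a5 a6].
have k1 := ler_norm K; have k2 := ler_norm K'.
have k3 := ler_norm (- x); have k4 := ler_norm (- y); rewrite !normrN in k3 k4.
have k5 : 0 <= `|K| by []. have k6 : 0 <= `|K'| by [].
have k7 : 0 <= `|x| by []. have k8 : 0 <= `|y| by [].
have NR : 0 <= (N%:R : R) by [].
have l1 : x * n.+1%:R <= (M + e / 2) * n.+1%:R by rewrite ler_pM2r// ltW.
have l2 : y * n.+1%:R <= (- M + e / 2) * n.+1%:R by rewrite ler_pM2r//; lra.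
have l3 : - x * N%:R <= `|x| * N%:R by exact: ler_wpM2r.
have l4 : - y * N%:R <= `|y| * N%:R by exact: ler_wpM2r.
have l5 : 0 <= `|x| * N%:R by rewrite mulr_ge0.
have l6 : 0 <= `|y| * N%:R by rewrite mulr_ge0.
rewrite /D in hn; apply/andP; split; lra.
Qed.

End Growth.

(** * Factors of words of complexity at most [n + k] *)

(** On an infinite set [fset_set] is empty and the count is 0, so finiteness is carried as a
    separate fact. *)
Definition factor_count (w : nat -> nat) (n : nat) : nat :=
  #|` fset_set (range (word_factor w n))|.

Lemma word_factorP (w : nat -> nat) (n i j : nat) :
  word_factor w n i = word_factor w n j <->
  forall t, (t < n)%N -> w (i + t)%N = w (j + t)%N.
Proof.
split=> [h t tn|h].
  have := congr1 (fun s => tnth s (Ordinal tn)) h.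
  by rewrite !tnth_mktuple.
by apply: eq_from_tnth => t; rewrite !tnth_mktuple h.
Qed.

(** A finite bound excludes the value [+oo], hence infinitely many factors; a negative [k] is
    replaced by its absolute value. *)
Lemma complexity_le_nat (R : realType) (w : nat -> nat) (k : int) :
  (forall n, (1 <= n)%N ->
     (complexity R n w <= ((n%:Z + k)%:~R : R)%:E)%E) ->
  forall n, (1 <= n)%N -> finite_set (range (word_factor w n)) /\
    (factor_count w n <= n + `|k|)%N.
Proof.
move=> wk n n1; have := wk n n1; rewrite /complexity /counting.
case: asboolP => // fin; rewrite lee_fin => h; split => //.
have : (#|` fset_set (range (word_factor w n))|)%:Z <= n%:Z + k.
  by rewrite -(ler_int R).
rewrite /factor_count; lia.
Qed.

Lemma bounded_letters (w : nat -> nat) :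
  finite_set (range (word_factor w 1)) -> exists B, forall i, (w i <= B)%N.
Proof.
move=> fin; pose S := fset_set (range (word_factor w 1)).
exists (\max_(s <- S) nth 0 (val s) 0)%N => i.
have iS : word_factor w 1 i \in S by rewrite in_fset_set// inE; exists i.
have -> : w i = nth 0%N (val (word_factor w 1 i)) 0.
  by rewrite -[RHS](tnth_nth _ _ ord0) tnth_mktuple addn0.
exact: leq_bigmax_seq.
Qed.

(** Dropping the last letter maps factors of length [n.+1] onto those of length [n]. Two factors
    with several extensions would force at least two more factors of length [n.+1] than of length
    [n]. *)
Lemma unique_right_special (w : nat -> nat) (n : nat) :
  finite_set (range (word_factor w n)) ->
  finite_set (range (word_factor w n.+1)) ->
  (factor_count w n.+1 <= (factor_count w n).+1)%N ->
  exists r, forall i j, word_factor w n i = word_factor w n j ->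
    word_factor w n i <> r -> w (i + n)%N = w (j + n)%N.
Proof.
move=> finn finS cardS.
have [|nspec] := pselect (exists i j, word_factor w n i = word_factor w n j /\
    w (i + n)%N <> w (j + n)%N); last first.
  (* When no factor has two extensions, any [r] will do. *)
  exists (word_factor w n 0) => i j ij _; apply: contrapT => wij.
  by apply: nspec; exists i, j.
move=> [i0 [j0 [ij0 wij0]]]; exists (word_factor w n i0) => i j ij ni.
apply: contrapT => wij.
pose S := fset_set (range (word_factor w n.+1)).
pose T := fset_set (range (word_factor w n)).
pose f (s : n.+1.-tuple nat) : n.-tuple nat :=
  [tuple tnth s (widen_ord (leqnSn n) t) | t < n].
have fE l : f (word_factor w n.+1 l) = word_factor w n l.
  by apply: eq_from_tnth => t; rewrite !tnth_mktuple.
have lastE l l' : word_factor w n.+1 l = word_factor w n.+1 l' ->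
    w (l + n)%N = w (l' + n)%N.
  by move/word_factorP; apply.
have inS l : word_factor w n.+1 l \in S by rewrite in_fset_set// inE; exists l.
(* One extension of each of the two special factors is removed; the other ones, at [j0] and [j],
   keep [f] onto [T]. *)
pose S' := (S `\ word_factor w n.+1 i0 `\ word_factor w n.+1 i)%fset.
have ii0 : word_factor w n.+1 i != word_factor w n.+1 i0.
  by apply/eqP => /(congr1 f); rewrite !fE.
have cS : (#|` S| = #|` S'| + 2)%N.
  rewrite /S' (cardfsD1 (word_factor w n.+1 i0) S) inS.
  rewrite (cardfsD1 (word_factor w n.+1 i) (S `\ _)%fset) !inE ii0 inS /=.
  lia.
have sub : (T `<=` f @` S')%fset.
  apply/fsubsetP => x; rewrite in_fset_set// inE => -[l _ <-].
  apply/imfsetP.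
  have [l0|l0] := eqVneq (word_factor w n l) (word_factor w n i0).
    exists (word_factor w n.+1 j0); last by rewrite fE l0 -ij0.
    rewrite !inE inS andbT; apply/andP; split.
      by apply/eqP => /(congr1 f); rewrite !fE -ij0 => /esym.
    by apply/eqP => /lastE /esym.
  have [li|li] := eqVneq (word_factor w n l) (word_factor w n i).
    exists (word_factor w n.+1 j); last by rewrite fE li ij.
    rewrite !inE inS andbT; apply/andP; split.
      by apply/eqP => /lastE /esym.
    by apply/eqP => /(congr1 f); rewrite !fE -ij.
  exists (word_factor w n.+1 l); last by rewrite fE.
  rewrite !inE inS andbT; apply/andP; split.
    by apply: contra li => /eqP /(congr1 f); rewrite !fE => ->.
  by apply: contra l0 => /eqP /(congr1 f); rewrite !fE => ->.
have TS' : (#|` T| <= #|` S'|)%N.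
  apply: leq_trans (fsubset_leq_card sub) _.
  by apply: leq_trans (leq_imfset_card _ _ _) _.
move: cardS; rewrite /factor_count -/S -/T cS addn2 => /leq_trans.
by move=> /(_ (#|` S'|.+1) TS'); rewrite ltnn.
Qed.

(** Pigeonhole on the [factor_count w n + 1] positions from [i] on. *)
Lemma repeated_factor (w : nat -> nat) (n i : nat) :
  finite_set (range (word_factor w n)) ->
  exists s t, [/\ (i <= s)%N, (s < t)%N, (t <= i + factor_count w n)%N &
    word_factor w n s = word_factor w n t].
Proof.
move=> fin; apply: contrapT => nrep.
pose p := factor_count w n; pose g (t : 'I_p.+1) := word_factor w n (i + t).
have ginj : injective g.
  move=> s t st; apply: val_inj => /=; apply: contrapT => /eqP; rewrite neq_ltn.
  have := ltn_ord s; have := ltn_ord t; move=> tp sp.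
  case/orP => lt; apply: nrep.
    by exists (i + s)%N, (i + t)%N; split => //; rewrite -/p; lia.
  by exists (i + t)%N, (i + s)%N; split => //; rewrite -/p; lia.
have sub : ([fset g t | t : 'I_p.+1] `<=` fset_set (range (word_factor w n)))%fset.
  apply/fsubsetP => x /imfsetP[t _ ->]; rewrite in_fset_set// inE.
  by exists (i + t)%N.
have := fsubset_leq_card sub; rewrite card_imfset//= -/(factor_count w n) -/p.
by rewrite -cardE card_ord ltnn.
Qed.

(* Outside r every factor of length n determines the next letter, so a
   factor repeated without meeting r in between starts a cycle. *)
Lemma avoid_special_periodic (w : nat -> nat) (n i d : nat) (r : n.-tuple nat) :
  (forall s t, word_factor w n s = word_factor w n t ->
    word_factor w n s <> r -> w (s + n)%N = w (t + n)%N) ->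
  (0 < d)%N -> word_factor w n i = word_factor w n (i + d) ->
  (forall t, (i <= t < i + d)%N -> word_factor w n t <> r) ->
  forall t, (i + n <= t)%N -> w t = w (t + d)%N.
Proof.
move=> det d0 id avoid.
(* The two claims feed each other: past the first cycle, avoidance of [r] comes from the equality at
   [t - d]; the equality at [t.+1] needs one new letter, which [det] supplies because [r] is avoided
   at [t]. *)
have P t : word_factor w n (i + t) <> r /\
    word_factor w n (i + t) = word_factor w n (i + t + d).
  elim/ltn_ind: t => t IH; split.
    have [td|dt] := ltnP t d; first by apply: avoid; lia.
    have [h1 h2] := IH (t - d)%N ltac:(lia).
    by move: h1; rewrite h2; have -> : (i + (t - d) + d = i + t)%N by lia.
  case: t IH => [|t] IH; first by rewrite addn0.
  have [h1 h2] := IH t (leqnn _).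
  apply/word_factorP => u un.
  have [un1|un1] := eqVneq u.+1 n.
    have := det _ _ h2 h1; rewrite -un1.
    have -> : (i + t + u.+1 = i + t.+1 + u)%N by lia.
    by have -> : (i + t + d + u.+1 = i + t.+1 + d + u)%N by lia.
  have := (word_factorP w n _ _).1 h2 u.+1 ltac:(lia).
  have -> : (i + t + u.+1 = i + t.+1 + u)%N by lia.
  by have -> : (i + t + d + u.+1 = i + t.+1 + d + u)%N by lia.
move=> t it; have [h1 h2] := P (t - (i + n))%N.
have := det _ _ h2 h1.
have -> : (i + (t - (i + n)) + n = t)%N by lia.
by have -> : (i + (t - (i + n)) + d + n = t + d)%N by lia.
Qed.

(** Otherwise [p] grows by at least 2 at each step from [n0] on, and [t = n0 + k + 1] gives
    [2 * t <= n0 + t + k], which is false. *)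
Lemma slow_growth_often (p : nat -> nat) (k : nat) :
  (forall n, (1 <= n)%N -> (p n <= n + k)%N) ->
  forall n0, exists n, (n0 <= n)%N /\ (p n.+1 <= (p n).+1)%N.
Proof.
move=> pk n0; apply: contrapT => h.
have grow t : (2 * t <= p (n0 + t))%N.
  elim: t => // t IH; rewrite addnS.
  have [//|lt] := leqP (2 * t.+1) (p (n0 + t).+1).
  exfalso; apply: h; exists (n0 + t)%N; split; first exact: leq_addr.
  lia.
have := grow (n0 + k).+1; have := pk (n0 + (n0 + k).+1)%N ltac:(lia); lia.
Qed.

Definition recurrent_factor (w : nat -> nat) (N C n : nat)
    (r : n.-tuple nat) : Prop :=
  forall i, (N <= i)%N ->
    exists j, [/\ (i <= j)%N, (j + n <= i + C * n)%N & word_factor w n j = r].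

(** The length [d * n0.+1] is at least [d], and the factor read at [N] returns at every multiple of
    [d] after [N], hence within [n] steps of any [i]. *)
Lemma periodic_recurrent_factor (w : nat -> nat) (N d : nat) :
  (0 < d)%N -> (forall t, (N <= t)%N -> w t = w (t + d)%N) ->
  forall n0, exists n (r : n.-tuple nat),
    (n0 <= n)%N /\ recurrent_factor w N 3 n r.
Proof.
move=> d0 per n0; exists (d * n0.+1)%N, (word_factor w (d * n0.+1) N).
split=> [|i Ni]; first nia.
have perq q t : (N <= t)%N -> w (t + q * d)%N = w t.
  elim: q => [|q IH] Nt; first by rewrite addn0.
  by rewrite -(IH Nt) mulSnr addnA -per//; lia.
have dv := divn_eq (i - N) d; have := ltn_pmod (i - N) d0.
set q := ((i - N) %/ d)%N in dv *; move=> md.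
exists (N + q.+1 * d)%N; split.
- rewrite mulSn; lia.
- rewrite mulSn; nia.
- apply/word_factorP => t _.
  have -> : (N + q.+1 * d + t = N + t + q.+1 * d)%N by lia.
  by rewrite perq ?leq_addr.
Qed.

Lemma quasi_sturmian_recurrent_factor (w : nat -> nat) (k : nat) :
  (forall n, (1 <= n)%N -> finite_set (range (word_factor w n)) /\
     (factor_count w n <= n + k)%N) ->
  exists N, forall n0, exists n (r : n.-tuple nat),
    (n0 <= n)%N /\ recurrent_factor w N 3 n r.
Proof.
move=> wk.
have [[N [d [d0 per]]]|aper] := pselect (exists N d, (0 < d)%N /\
    forall t, (N <= t)%N -> w t = w (t + d)%N).
  by exists N; exact: periodic_recurrent_factor d0 per.
exists 0%N => n0.
(* Taking [n > n0 + k] gives [p(n) <= n + k <= 2 * n], so an occurrence starting at most [p(n)]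
   after [i] ends within the window of length [3 * n]. *)
have [n [nn slow]] := @slow_growth_often (factor_count w) k
  (fun n h => (wk n h).2) (n0 + k).+1.
have [fin cn] := wk n ltac:(lia); have [finS _] := wk n.+1 isT.
have [r det] := unique_right_special w n fin finS slow.
exists n, r; split; first lia.
move=> i _; apply: contrapT => nrec.
have avoid t : (i <= t <= i + factor_count w n)%N -> word_factor w n t <> r.
  by move=> it tr; apply: nrec; exists t; split => //; lia.
have [s [t [is_ st ti eqst]]] := repeated_factor w n i fin.
apply: aper; exists (s + n)%N, (t - s)%N; split; first lia.
apply: (avoid_special_periodic w n s (t - s) r) => //.
- lia.
- by rewrite subnKC// ltnW.
- by move=> u ?; apply: avoid; lia.
Qed.

(** * Continuants and convergents *)

(** Continuant of the [n] letters from [w i] on, expanded along the first letter because [cfrac]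
    peels its quotients from that side. *)
Fixpoint continuant (w : nat -> nat) (i n : nat) : nat :=
  match n with
  | 0 => 1
  | 1 => w i
  | (m.+1 as p).+1 => w i * continuant w i.+1 p + continuant w i.+2 m
  end%N.

Lemma continuantSS (w : nat -> nat) (i n : nat) :
  continuant w i n.+2 =
  (w i * continuant w i.+1 n.+1 + continuant w i.+2 n)%N.
Proof. by []. Qed.

Lemma nat_ind2 (P : nat -> Prop) :
  P 0%N -> P 1%N -> (forall n, P n -> P n.+1 -> P n.+2) -> forall n, P n.
Proof.
move=> P0 P1 PS n; suff [] : P n /\ P n.+1 by [].
by elim: n => [|n [Pn PSn]]; split => //; exact: PS.
Qed.

Lemma continuant_factor (w : nat -> nat) (n i j : nat) :
  (forall t, (t < n)%N -> w (i + t)%N = w (j + t)%N) ->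
  continuant w i n = continuant w j n.
Proof.
elim/nat_ind2: n i j => [//|i j h|n IH1 IH2 i j h].
  by have := h 0%N isT; rewrite !addn0.
have := h 0%N isT; rewrite !addn0 !continuantSS => ->.
congr (_ * _ + _)%N; [apply: IH2|apply: IH1] => t tn.
- by rewrite !addSnnS; exact: h.
- by rewrite !addSnnS; exact: h.
Qed.

Section Continuant.
Context (w : nat -> nat) (w_pos : forall i, (0 < w i)%N).

Lemma continuant_gt0 i n : (0 < continuant w i n)%N.
Proof.
elim/nat_ind2: n i => [//|i|n _ IH i]; first exact: w_pos.
by rewrite continuantSS addn_gt0 muln_gt0 w_pos IH.
Qed.

Lemma continuant_le_succ i n : (continuant w i.+1 n <= continuant w i n.+1)%N.
Proof.
case: n => [|n]; first exact: w_pos.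
by rewrite continuantSS; apply: leq_trans (leq_addr _ _); rewrite leq_pmull.
Qed.

(** For a fixed right-hand word, both sides obey the same recurrence in the left-hand word, so the
    cases of 0 and 1 letters suffice; likewise for the upper bound. *)
Lemma continuant_cat_ge i m n :
  (continuant w i m * continuant w (i + m) n <= continuant w i (m + n))%N.
Proof.
elim/nat_ind2: m i => [i|i|m IH1 IH2 i]; first by rewrite mul1n addn0.
  by case: n => [|n]; rewrite ?muln1// addn1 add1n continuantSS leq_addr.
rewrite !addSn !continuantSS.
have := IH1 i.+2; have := IH2 i.+1.
have -> : (i.+1 + m.+1 = i + m.+2)%N by lia.
have -> : (i.+2 + m = i + m.+2)%N by lia.
rewrite addSn; nia.
Qed.

Lemma continuant_cat_le i m n :
  (continuant w i (m + n) <= 2 * (continuant w i m * continuant w (i + m) n))%N.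
Proof.
elim/nat_ind2: m i => [i|i|m IH1 IH2 i].
- by rewrite mul1n addn0 leq_pmull.
(* The factor 2 arises here: dropping the first letter of the right-hand word does not increase its
   continuant, and [w i] is at least 1. *)
- case: n => [|n]; first by rewrite /= muln1 leq_pmull.
  rewrite addn1 add1n continuantSS -[continuant w i 1]/(w i).
  have := continuant_le_succ i.+1 n; have := w_pos i; nia.
- rewrite !addSn !continuantSS.
  have := IH1 i.+2; have := IH2 i.+1.
  have -> : (i.+1 + m.+1 = i + m.+2)%N by lia.
  have -> : (i.+2 + m = i + m.+2)%N by lia.
  rewrite addSn; nia.
Qed.

Lemma continuant_le_exp B i n :
  (forall j, (w j <= B)%N) -> (continuant w i n <= B.+1 ^ n)%N.
Proof.
move=> wB; elim/nat_ind2: n i => [//|i|n IH1 IH2 i].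
  by rewrite expn1; exact: leqW (wB i).
rewrite continuantSS; have := IH1 i.+2; have := IH2 i.+1; have := wB i.
rewrite !expnS; nia.
Qed.

Lemma continuant_coprime i n :
  coprime (continuant w i n.+1) (continuant w i.+1 n).
Proof.
elim: n i => [|n IH] i; first by rewrite coprimen1.
by rewrite continuantSS coprime_sym /coprime gcdnMDl; exact: IH.
Qed.

Lemma cfrac_continuant (F : numFieldType) s n :
  cfrac F (fun i => (w (s + i)%N)%:Z) n =
  (continuant w s n.+1)%:R / (continuant w s.+1 n)%:R.
Proof.
elim: n s => [|n IH] s; first by rewrite /= addn0 divr1.
rewrite [LHS]/=.
have -> : (fun i => (w (s + i.+1)%N)%:Z) = (fun i => (w (s.+1 + i)%N)%:Z).
  by apply/funext => i; rewrite addnS.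
rewrite IH continuantSS addn0 invf_div natrD natrM mulrDl mulfK//.
by rewrite pnatr_eq0 -lt0n continuant_gt0.
Qed.

(** The zero integer part inverts the fraction, so its numerator becomes the denominator;
    coprimality rules out any cancellation. *)
Lemma cfrac_word_den n :
  denq (cfrac rat (cf_quotients_of_word w) n.+1) = (continuant w 0 n.+1)%:Z.
Proof.
have -> : cfrac rat (cf_quotients_of_word w) n.+1 =
    (cfrac rat (fun i => (w (0 + i)%N)%:Z) n)^-1.
  by rewrite /= mulr0z add0r.
rewrite cfrac_continuant invf_div !pmulrn coprimeq_den; last first.
  by rewrite coprime_sym; exact: continuant_coprime.
by rewrite eqz_nat gtn_eqF// continuant_gt0.
Qed.

(** * Convergence, complete quotients and irrationality of the infinite fraction *)

Section Limit.
Context (R : realType).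

Let cw s n := cfrac R (fun i => (w (s + i)%N)%:Z) n.

Let cwS s n : cw s n.+1 = (w s)%:R + (cw s.+1 n)^-1.
Proof.
rewrite /cw /= addn0; congr (_ + (cfrac _ _ _)^-1).
by apply/funext => i; rewrite addnS.
Qed.

Let wR s : 1 <= ((w s)%:R : R).
Proof. by rewrite ler1n. Qed.

Let cw_bounds s n : (w s)%:R <= cw s n <= (w s)%:R + 1.
Proof.
elim: n s => [|n IH] s; first by rewrite /cw /= addn0 lexx ler_wpDr.
rewrite cwS lerDl lerD2l; have /andP[h _] := IH s.+1.
have c1 : 1 <= cw s.+1 n := le_trans (wR _) h.
by rewrite invr_ge0 (le_trans ler01 c1) invf_le1// (lt_le_trans ltr01 c1).
Qed.

Let cw_ge1 s n : 1 <= cw s n.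
Proof. by have /andP[h _] := cw_bounds s n; exact: le_trans h. Qed.

(** Two levels are unfolded at once: one level alone does not contract uniformly near 1, whereas two
    divide the difference by [(q * a + 1) * (q * b + 1)], with both factors at least 2. *)
Let cw_contract s n m :
  `|cw s n.+2 - cw s m.+2| <= 2^-1 * `|cw s.+2 n - cw s.+2 m|.
Proof.
rewrite !cwS; have := cw_ge1 s.+2 n; have := cw_ge1 s.+2 m; have := wR s.+1.
move: (cw _ _) (cw _ _) ((w s.+1)%:R) => a b q q1 b1 a1.
have qa : 2 <= q * a + 1 by nra.
have qb : 2 <= q * b + 1 by nra.
have h (x : R) : 1 <= x -> 2 <= q * x + 1 -> (q + x^-1)^-1 = x / (q * x + 1).
  move=> x1 qx.
  have -> : q + x^-1 = (q * x + 1) / x by field; lra.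
  by rewrite invf_div.
rewrite (h a)// (h b)//.
have -> : (w s)%:R + a / (q * a + 1) - ((w s)%:R + b / (q * b + 1)) =
    (a - b) / ((q * a + 1) * (q * b + 1)) by field; lra.
rewrite normrM mulrC; apply: ler_wpM2r => //.
have p0 : 2 <= (q * a + 1) * (q * b + 1) by nra.
rewrite gtr0_norm ?invr_gt0; last lra.
by rewrite lef_pV2 ?posrE//; lra.
Qed.

Let cw_cauchy j s n m : `|cw s (2 * j + n)%N - cw s (2 * j + m)%N| <= 2^-1 ^+ j.
Proof.
elim: j s => [|j IH] s.
  rewrite muln0 !add0n expr0 ler_norml.
  have := cw_bounds s n; have := cw_bounds s m; lra.
have E x : (2 * j.+1 + x = (2 * j + x).+2)%N by lia.
rewrite !E exprS; apply: le_trans (cw_contract _ _ _) _.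
by apply: ler_wpM2l => //; rewrite invr_ge0.
Qed.

Let cw_cvg s : cvgn (cw s).
Proof.
apply: R_complete; apply: cauchy_exP => e e0.
have [j hj] := archi_nat_gt R e^-1.
exists (cw s (2 * j)%N); exists (2 * j)%N => // n /= jn.
rewrite /ball /= -{1}(addn0 (2 * j)%N) -(subnKC jn).
apply: le_lt_trans (cw_cauchy _ _ _ _) _.
rewrite exprVn -[ltRHS]invrK ltf_pV2 ?posrE ?exprn_gt0 ?invr_gt0//.
apply: lt_le_trans (hj j (leqnn j)) _.
by rewrite -natrX ler_nat ltnW// ltn_expl.
Qed.

Let y s : R := lim (cw s n @[n --> \oo]).

Let y_ge1 s : 1 <= y s.
Proof. by apply: limr_ge; [exact: cw_cvg|apply: nearW => n; exact: cw_ge1]. Qed.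

Let yS s : y s = (w s)%:R + (y s.+1)^-1.
Proof.
have y0 : y s.+1 != 0 by rewrite gt_eqF// (lt_le_trans ltr01 (y_ge1 _)).
apply: cvg_lim => //; rewrite -cvg_shiftS /=.
under eq_fun do rewrite cwS.
by apply: cvgD; [exact: cvg_cst|apply: cvgV => //; exact: cw_cvg].
Qed.

(** Strictness puts the inverse in the open unit interval, so that the floor of [y s] is exactly
    [w s]. *)
Let y_gt1 s : 1 < y s.
Proof.
rewrite yS; have := wR s; have : 0 < (y s.+1)^-1.
  by rewrite invr_gt0 (lt_le_trans ltr01 (y_ge1 _)).
lra.
Qed.

Let yV s : 0 < (y s)^-1 < 1.
Proof.
have y0 : 0 < y s := lt_trans ltr01 (y_gt1 s).
by rewrite invr_gt0 y0 invf_lt1 ?y_gt1.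
Qed.

Let x := inf_cfrac R (cf_quotients_of_word w).

Let xE : x = (y 0%N)^-1.
Proof.
have y0 : y 0%N != 0 by rewrite gt_eqF// (lt_trans ltr01 (y_gt1 _)).
apply: cvg_lim => //; rewrite -cvg_shiftS /=.
under eq_fun do rewrite mulr0z add0r.
by apply: cvgV => //; exact: cw_cvg.
Qed.

Let floor_y s : Num.floor (y s) = (w s)%:Z.
Proof.
apply: floor_def; rewrite yS intrD -pmulrn.
have := yV s.+1; lra.
Qed.

Let complete_quotient_word n : complete_quotient x n.+1 = y n.
Proof.
elim: n => [|n IH].
  rewrite /= xE (@floor_def _ _ 0) ?subr0 ?invrK//.
  by have /andP[h1 h2] := yV 0; rewrite mulr0z add0r mulr1z (ltW h1) h2.
rewrite [LHS]/= -/(complete_quotient x n.+1) IH floor_y yS -pmulrn.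
by rewrite addrC addKr invrK.
Qed.

Lemma partial_quotient_word :
  partial_quotient (inf_cfrac R (cf_quotients_of_word w)) =
  cf_quotients_of_word w.
Proof.
apply/funext => -[|n]; rewrite /partial_quotient -/x.
  rewrite /= xE (@floor_def _ _ 0)//.
  by have /andP[h1 h2] := yV 0; rewrite mulr0z add0r mulr1z (ltW h1) h2.
by rewrite complete_quotient_word floor_y.
Qed.

(* Taking a complete quotient of a rational number strictly decreases the
   denominator, as in the Euclidean algorithm. *)
Let y_irrational (q p s : nat) : y s * q%:R <> p%:R \/ q = 0%N.
Proof.
elim/ltn_ind: q p s => q IH p s; case: (posnP q) => [|q0]; first by right.
left => yq; have y0 : 0 < y s.+1 := lt_trans ltr01 (y_gt1 s.+1).
have qR : 0 < (q%:R : R) by rewrite ltr0n.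
have e : q%:R = y s.+1 * (p%:R - (w s)%:R * q%:R).
  by rewrite -yq (yS s); field; rewrite gt_eqF.
have d0 : 0 < p%:R - (w s)%:R * q%:R :> R.
  by rewrite -(pmulr_rgt0 _ y0) -e.
have lt1 : (w s * q < p)%N by rewrite -(ltr_nat R) natrM; lra.
have e' : y s.+1 * (p - w s * q)%:R = q%:R.
  by rewrite natrB ?natrM; [exact/esym|exact: ltnW].
have lt2 : (p - w s * q < q)%N.
  rewrite -(ltr_nat R) -e'; rewrite ltr_pMl ?y_gt1// ltr0n subn_gt0//.
have [] := IH _ lt2 q s.+1; first by rewrite e'.
lia.
Qed.

Lemma inf_cfrac_irrational :
  irrational (inf_cfrac R (cf_quotients_of_word w)).
Proof.
rewrite -/x => -[q _ qx].
have y0 : 0 < y 0 := lt_trans ltr01 (y_gt1 0).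
have x0 : 0 < x by rewrite xE invr_gt0.
have q0 : 0 < q by rewrite -(ltr0q R) qx.
have nq : 0 < numq q by rewrite numq_gt0.
have [] := y_irrational `|numq q| `|denq q| 0; last lia.
apply.
have -> : y 0 = x^-1 by rewrite xE invrK.
rewrite -qx /ratr invf_div !natr_absz !gtr0_norm ?denq_gt0//.
by rewrite divfK// intr_eq0 gt_eqF.
Qed.

End Limit.
End Continuant.

(** * Logarithms of continuants and the limit of their averages *)

Lemma ln_continuant_cat (R : realType) (w : nat -> nat) :
  (forall i, (0 < w i)%N) -> forall i m n,
  `|ln ((continuant w i (m + n))%:R : R) - ln (continuant w i m)%:R
    - ln (continuant w (i + m) n)%:R| <= ln 2.
Proof.
move=> w_pos i m n.
have K0 j l : 0 < ((continuant w j l)%:R : R) by rewrite ltr0n continuant_gt0.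
have KK : 0 < (continuant w i m)%:R * (continuant w (i + m) n)%:R :> R.
  by rewrite mulr_gt0.
have ln20 : 0 <= ln (2 : R) by rewrite ln_ge0// ler1n.
rewrite -addrA -opprD -lnM ?posrE//.
have h1 : ln ((continuant w i m)%:R * (continuant w (i + m) n)%:R) <=
    ln ((continuant w i (m + n))%:R : R).
  by rewrite ler_ln ?posrE// -natrM ler_nat continuant_cat_ge.
have h2 : ln ((continuant w i (m + n))%:R : R) <=
    ln (2 * ((continuant w i m)%:R * (continuant w (i + m) n)%:R)).
  rewrite ler_ln ?posrE// ?mulr_gt0//.
  by rewrite -!natrM ler_nat continuant_cat_le.
rewrite [X in _ <= X]lnM ?posrE// in h2.
rewrite ler_norml; apply/andP; split; lra.
Qed.

Theorem theorem1p1 (R : realType) (w : nat -> nat)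
    (w_pos : forall i : nat, (0 < w i)%N)
    (w_complexity : exists k : int, forall n : nat, (1 <= n)%N ->
       (complexity R n w <= ((n%:Z + k)%:~R : R)%:E)%E) :
  has_Levy_constant (inf_cfrac R (cf_quotients_of_word w)).
Proof.
have [k wk] := w_complexity; have wk' := complexity_le_nat R w k wk.
have [B wB] := bounded_letters w (wk' 1%N isT).1.
have [N rec] := quasi_sturmian_recurrent_factor w `|k| wk'.
split; first exact: inf_cfrac_irrational.
pose F i n : R := ln (continuant w i n)%:R.
have -> : (fun n => ln ((convergent_den
      (inf_cfrac R (cf_quotients_of_word w)) n.+1)%:~R : R) / n.+1%:R) =
    (fun n => F 0%N n.+1 / n.+1%:R).
  apply/funext => n; rewrite /convergent_den /convergent.
  by rewrite partial_quotient_word// cfrac_word_den// -pmulrn.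
(* The constants: windows of length [3 * n] for recurrence, error [ln 2] per cut, and growth at most
   [ln (B + 1)] per letter. *)
apply: (average_cvg R F N 3 (ln 2) (ln B.+1%:R)) => //.
- exact: ln_continuant_cat.
- move=> i n; have K0 := continuant_gt0 w w_pos i n.
  rewrite /F ger0_norm ?ln_ge0 ?ler1n//.
  rewrite mulr_natr -lnXn// ler_ln ?posrE ?exprn_gt0 ?ltr0n//.
  by rewrite -natrX ler_nat continuant_le_exp.
- move=> n0; have [n [r [n0n rn]]] := rec n0.
  (* One occurrence of [r] is fixed to name its value; all others share it, since a continuant
     depends only on the letters read. *)
  have [j0 [_ _ rj0]] := rn N (leqnn N).
  exists n, (F j0 n); split => // i /rn[j [ij jn rj]].
  exists j; split => //; congr (ln _%:R); apply: continuant_factor.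
  by apply/word_factorP; rewrite rj rj0.
Qed.
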